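(* Real Value Perception Manipulation (RVPM) can be solved in polynomial time under the $l_\infty$ norm when the number of issues $d$ is a constant, for destructive control and arbitrary scoring rules.
   Context: Spatial election model: $n$ candidates $c_1,\dots,c_n$ and $m$ voters $v_1,\dots,v_m$ are points of $\mathbb R^d$. Each voter ranks candidates by increasing $l_\infty$ distance; closest ranked 1; original rankings have no ties. A scoring rule is a non-increasing $f:\{1,\dots,n\}\to\mathbb R$: a candidate ranked $t$ by a voter receives $f(t)$; totals summed; highest total wins. Given $\epsilon>0$, an adversary may replace target $c_1$ by any $\tilde c_1\in\mathbb R^d$ with $\|\tilde c_1-c_1\|_\infty\le\epsilon$; ties created by the manipulation are broken in the adversary's favor. Destructive control: decide whether some such $\tilde c_1$ makes $c_1$ lose (with $c_1$ placed behind equidistant candidates, some other candidate's total is at least $c_1$'s total). *)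

(* Defs.v *)
From Stdlib Require Import Reals Lra Lia List Bool.
Import ListNotations.
Open Scope R_scope.

Definition Rltb (a b : R) : bool := if Rlt_dec a b then true else false.
Definition Rleb (a b : R) : bool := if Rle_dec a b then true else false.

(* points of R^d are functions nat -> R; only coordinates 0..d-1 matter *)
Definition dinf (d : nat) (x y : nat -> R) : R :=
  fold_right Rmax 0 (map (fun k => Rabs (x k - y k)) (seq 0 d)).

Definition rsum (l : list R) : R := fold_right Rplus 0 l.

(* Candidates C 0, ..., C (n-1) (C 0 is the target c_1), voters V 0..V (m-1).
   x is the (possibly moved) position of the target.  Ties between the
   target and another candidate are broken against the target. *)
Definition rank_target (d n : nat) (C : nat -> nat -> R) (x v : nat -> R) : nat :=
  S (length (filter (fun i => Rleb (dinf d (C i) v) (dinf d x v)) (seq 1 (n - 1)))).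

Definition rank_other (d n : nat) (C : nat -> nat -> R) (x v : nat -> R) (j : nat) : nat :=
  S (length (filter (fun i => andb (negb (Nat.eqb i j)) (Rltb (dinf d (C i) v) (dinf d (C j) v)))
                    (seq 1 (n - 1)))
     + (if Rltb (dinf d x v) (dinf d (C j) v) then 1 else 0))%nat.

Definition score_target d n m C V (f : nat -> R) x : R :=
  rsum (map (fun v => f (rank_target d n C x (V v))) (seq 0 m)).

Definition score_other d n m C V (f : nat -> R) x j : R :=
  rsum (map (fun v => f (rank_other d n C x (V v) j)) (seq 0 m)).

Definition destructive_control (d n m : nat) (C V : nat -> nat -> R)
  (f : nat -> R) (eps : R) : Prop :=
  exists x : nat -> R,
    (forall k, (k < d)%nat -> Rabs (x k - C 0%nat k) <= eps) /\
    exists j, (1 <= j < n)%nat /\ score_other d n m C V f x j >= score_target d n m C V f x.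

Inductive instr : Type :=
| NConst (a c : nat)
| NAdd (a b c : nat)
| NSub (a b c : nat)          (* N[a] := N[b] - N[c] (truncated) *)
| RFromN (a b : nat)
| RAdd (a b c : nat)
| RSub (a b c : nat)
| RMul (a b c : nat)
| RDiv (a b c : nat)
| RLoad (a b : nat)           (* R[a] := R[N[b]] *)
| RStore (a b : nat)          (* R[N[a]] := R[b] *)
| JLtR (a b t : nat)
| JLtN (a b t : nat)
| Jmp (t : nat)
| Halt.

Record state : Type := mkState { pc : nat; Nreg : nat -> nat; Rreg : nat -> R }.

Definition updN (g : nat -> nat) (a v : nat) : nat -> nat :=
  fun i => if Nat.eqb i a then v else g i.
Definition updR (g : nat -> R) (a : nat) (v : R) : nat -> R :=
  fun i => if Nat.eqb i a then v else g i.

Definition step (P : list instr) (s : state) : option state :=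
  let N := Nreg s in let Rg := Rreg s in let p := pc s in
  match nth_error P p with
  | None => None
  | Some Halt => None
  | Some (NConst a c) => Some (mkState (S p) (updN N a c) Rg)
  | Some (NAdd a b c) => Some (mkState (S p) (updN N a (N b + N c)%nat) Rg)
  | Some (NSub a b c) => Some (mkState (S p) (updN N a (N b - N c)%nat) Rg)
  | Some (RFromN a b) => Some (mkState (S p) N (updR Rg a (INR (N b))))
  | Some (RAdd a b c) => Some (mkState (S p) N (updR Rg a (Rg b + Rg c)))
  | Some (RSub a b c) => Some (mkState (S p) N (updR Rg a (Rg b - Rg c)))
  | Some (RMul a b c) => Some (mkState (S p) N (updR Rg a (Rg b * Rg c)))
  | Some (RDiv a b c) => Some (mkState (S p) N (updR Rg a (Rg b / Rg c)))
  | Some (RLoad a b) => Some (mkState (S p) N (updR Rg a (Rg (N b))))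
  | Some (RStore a b) => Some (mkState (S p) N (updR Rg (N a) (Rg b)))
  | Some (JLtR a b t) => Some (mkState (if Rltb (Rg a) (Rg b) then t else S p) N Rg)
  | Some (JLtN a b t) => Some (mkState (if Nat.ltb (N a) (N b) then t else S p) N Rg)
  | Some (Jmp t) => Some (mkState t N Rg)
  end.

Fixpoint steps (P : list instr) (s : state) (t : nat) : option state :=
  match t with
  | O => Some s
  | S t' => match step P s with None => None | Some s' => steps P s' t' end
  end.

Definition halted (P : list instr) (s : state) : Prop := step P s = None.

(* Input encoding.  Nat registers: N[0] = n, N[1] = m, others 0.
   Real registers: R[0] = eps; R[1 + i*d + k] = C i k (i<n, k<d);
   R[1 + n*d + v*d + k] = V v k (v<m, k<d); R[1 + n*d + m*d + t] = f (t+1)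
   (t<n); all other registers 0.  Output: N[0] <> 0 means "yes". *)
Definition init_state (d n m : nat) (C V : nat -> nat -> R) (f : nat -> R) (eps : R)
  : state :=
  mkState 0
    (fun i => if Nat.eqb i 0 then n else if Nat.eqb i 1 then m else 0%nat)
    (fun r =>
       if Nat.eqb r 0 then eps
       else let q := (r - 1)%nat in
       if Nat.ltb q (n * d) then C (q / d)%nat (q mod d)%nat
       else let q2 := (q - n * d)%nat in
       if Nat.ltb q2 (m * d) then V (q2 / d)%nat (q2 mod d)%nat
       else let q3 := (q2 - m * d)%nat in
       if Nat.ltb q3 n then f (S q3) else 0).

(* Main.v *)
Require Import Defs.
From Stdlib Require Import Reals Lra Lia List Bool Arith.
Import ListNotations.
Open Scope R_scope.

(** For each coordinate [k], call break points the numbers [C 0 k - eps], [C 0 k + eps] and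
    [V v k - r], [V v k + r], where [r] is the distance of some candidate to voter [v].  As
    [dinf d x v < r] says that [0 < r] and that each [x k] lies strictly between [v k - r] and
    [v k + r], the feasibility of [x] and all the ranks depend only on how each [x k] compares
    with the break points of its coordinate.  Hence each [x k] may be replaced by the midpoint
    of its two neighbouring break points (both equal to [x k] if it is itself a break point),
    and it suffices to try the polynomially many points whose coordinates are midpoints of two
    break points.

    The exhaustive test is one real expression, built from input cells by arithmetic,
    comparisons and sums over [0, n) and [0, m), which is positive iff some tried point works.
    Such expressions compile to the machine, with cost polynomial in [n + m + 1]. *)

(** * Execution of code fragments *)

Fixpoint code_at (P : list instr) (p : nat) (c : list instr) : Prop :=
  match c with
  | [] => True
  | i :: c' => nth_error P p = Some i /\ code_at P (S p) c'
  end.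

Lemma code_at_app P p c1 c2 :
  code_at P p (c1 ++ c2) <-> code_at P p c1 /\ code_at P (p + length c1) c2.
Proof.
  revert p; induction c1 as [|i c1 IH]; intros p; simpl.
  - rewrite Nat.add_0_r. tauto.
  - rewrite IH. replace (S p + length c1)%nat with (p + S (length c1))%nat by lia. tauto.
Qed.

Lemma code_at_infix pre c post : code_at (pre ++ c ++ post) (length pre) c.
Proof.
  revert pre; induction c as [|i c IH]; intros pre; simpl; [exact I|split].
  - rewrite nth_error_app2, Nat.sub_diag by lia. reflexivity.
  - specialize (IH (pre ++ [i])). rewrite length_app, <- app_assoc in IH.
    simpl in IH. rewrite Nat.add_1_r in IH. exact IH.
Qed.

(** Only an upper bound on the number of steps is kept, so that branches and loops of different
    lengths can share one estimate. *)
Definition reaches (P : list instr) (s : state) (T : nat) (s' : state) : Prop :=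
  exists t, (t <= T)%nat /\ steps P s t = Some s'.

Lemma reaches_refl P s : reaches P s 0 s.
Proof. exists 0%nat; auto. Qed.

Lemma reaches_step P s s' T s'' :
  step P s = Some s' -> reaches P s' T s'' -> reaches P s (S T) s''.
Proof.
  intros H [t [Ht E]]. exists (S t); split; [lia|]. simpl. rewrite H. exact E.
Qed.

Lemma reaches_trans P s1 T1 s2 T2 s3 :
  reaches P s1 T1 s2 -> reaches P s2 T2 s3 -> reaches P s1 (T1 + T2) s3.
Proof.
  intros [t1 [H1 E1]] [t2 [H2 E2]]. exists (t1 + t2)%nat; split; [lia|]. clear H1 H2.
  revert s1 E1; induction t1 as [|t1 IH]; simpl; intros s1 E1.
  - congruence.
  - destruct (step P s1); [auto|discriminate].
Qed.

Lemma reaches_weaken P s T T' s' : reaches P s T s' -> (T <= T')%nat -> reaches P s T' s'.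
Proof. intros [t [H E]] HT. exists t; split; [lia|exact E]. Qed.

Ltac exec1 H :=
  eapply reaches_step; [unfold step; cbn [pc Nreg Rreg];
    first [rewrite H | cbn [Nat.add]; rewrite H]; reflexivity|].

Lemma updN_eq g a v : updN g a v a = v.
Proof. unfold updN. now rewrite Nat.eqb_refl. Qed.

Lemma updN_neq g a v i : i <> a -> updN g a v i = g i.
Proof. intros H. unfold updN. now apply Nat.eqb_neq in H as ->. Qed.

Lemma updR_eq g a v : updR g a v a = v.
Proof. unfold updR. now rewrite Nat.eqb_refl. Qed.

Lemma updR_neq g a v i : i <> a -> updR g a v i = g i.
Proof. intros H. unfold updR. now apply Nat.eqb_neq in H as ->. Qed.

(** * Real-valued expressions with bounded sums *)

Inductive arith : Type := Add | Sub | Div.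

(* The environment is the bank of nat registers; a [Sum] met at level [l] binds
   register [l], and only registers below the current level can be read.
   [Sum false] ranges over [0, n) and [Sum true] over [0, m). *)
Inductive rexp : Type :=
| Num (c : nat) (vs : list nat)
| Get (c : nat) (vs : list nat)
| Op (o : arith) (e1 e2 : rexp)
| If (e1 e2 e3 e4 : rexp)
| Sum (b : bool) (e : rexp).

(** Both [eval] and [comp] filter their address lists in this way, so the correctness of compilation
    needs no well-formedness condition on expressions. *)
Definition visible (l : nat) (vs : list nat) : list nat := filter (fun a => Nat.ltb a l) vs.

Definition addr (env : nat -> nat) (c : nat) (vs : list nat) : nat :=
  fold_left (fun s a => s + env a)%nat vs c.

Definition arith_fun (o : arith) : R -> R -> R :=
  match o with Add => Rplus | Sub => Rminus | Div => Rdiv end.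

Definition bound_reg (b : bool) : nat := if b then 1%nat else 0%nat.

Fixpoint eval (inp : nat -> R) (l : nat) (env : nat -> nat) (e : rexp) : R :=
  match e with
  | Num c vs => INR (addr env c (visible l vs))
  | Get c vs => inp (addr env c (visible l vs))
  | Op o e1 e2 => arith_fun o (eval inp l env e1) (eval inp l env e2)
  | If e1 e2 e3 e4 =>
      if Rltb (eval inp l env e1) (eval inp l env e2)
      then eval inp l env e3 else eval inp l env e4
  | Sum b e =>
      rsum (map (fun i => eval inp (S l) (updN env l i) e) (seq 0 (env (bound_reg b))))
  end.

Lemma addr_ext env env' l c vs :
  (forall a, (a < l)%nat -> env' a = env a) ->
  addr env' c (visible l vs) = addr env c (visible l vs).
Proof.
  intros H. revert c; induction vs as [|a vs IH]; intros c; simpl; [reflexivity|].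
  destruct (Nat.ltb_spec a l); simpl; [rewrite H by assumption|]; apply IH.
Qed.

(** The bound [2 <= l] keeps registers 0 and 1, which hold the ranges of the sums, among those on
    which the environments agree. *)
Lemma eval_ext inp inp' e : forall l env env',
  (2 <= l)%nat -> (forall q, inp' q = inp q) -> (forall a, (a < l)%nat -> env' a = env a) ->
  eval inp' l env' e = eval inp l env e.
Proof.
  induction e as [c vs|c vs|o e1 IH1 e2 IH2|e1 IH1 e2 IH2 e3 IH3 e4 IH4|b e IH];
    intros l env env' Hl Hi He; simpl.
  - now rewrite (addr_ext env env').
  - now rewrite (addr_ext env env').
  - now rewrite (IH1 l env env'), (IH2 l env env').
  - now rewrite (IH1 l env env'), (IH2 l env env'), (IH3 l env env'), (IH4 l env env').
  - rewrite He by (destruct b; simpl; lia). f_equal. apply map_ext. intros i.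
    apply IH; [lia|exact Hi|]. intros a Ha. unfold updN.
    destruct (Nat.eqb_spec a l); [reflexivity|apply He; lia].
Qed.

Lemma rsum_snoc xs x : rsum (xs ++ [x]) = rsum xs + x.
Proof. induction xs; simpl; lra. Qed.

(** * Compilation *)

Definition addr_code (t c : nat) (vs : list nat) : list instr :=
  NConst t c :: map (fun a => NAdd t t a) vs.

Definition arith_instr (o : arith) : nat -> nat -> nat -> instr :=
  match o with Add => RAdd | Sub => RSub | Div => RDiv end.

(* [comp K p l r e] is the code, to be placed at address [p], that leaves the value of
   [e] in real register [r], with real scratch registers in [r, K) and nat scratch
   registers from [l] on.  The input cells below [K], overwritten by scratch values,
   are read from the copy that starts at the address held in nat register 2. *)
Fixpoint comp (K p l r : nat) (e : rexp) : list instr :=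
  match e with
  | Num c vs => addr_code l c (visible l vs) ++ [RFromN r l]
  | Get c vs =>
      let a := addr_code l c (visible l vs) in
      let q := (p + length a)%nat in
      a ++ [NConst (S l) K; JLtN l (S l) (3 + q); Jmp (4 + q); NAdd l l 2; RLoad r l]
  | Op o e1 e2 =>
      let c1 := comp K p l r e1 in
      let c2 := comp K (p + length c1) l (S r) e2 in
      c1 ++ c2 ++ [arith_instr o r r (S r)]
  | If e1 e2 e3 e4 =>
      let c1 := comp K p l r e1 in
      let c2 := comp K (p + length c1) l (S r) e2 in
      let q := (p + length c1 + length c2)%nat in
      let c4 := comp K (S q) l r e4 in
      let q' := (S q + length c4)%nat in
      let c3 := comp K (S q') l r e3 in
      c1 ++ c2 ++ [JLtR r (S r) (S q')] ++ c4 ++ [Jmp (S q' + length c3)%nat] ++ c3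
  | Sum b e =>
      let c := comp K (4 + p) (S l) (S r) e in
      [NConst l 0; RFromN r l; JLtN l (bound_reg b) (4 + p); Jmp (8 + p + length c)%nat]
        ++ c ++ [RAdd r r (S r); NConst (S l) 1; NAdd l l (S l); Jmp (2 + p)]
  end.

(** A generous bound on the real scratch registers used by [comp]: depths of subexpressions are
    added even where their registers are reused. *)
Fixpoint depth (e : rexp) : nat :=
  match e with
  | Num _ _ | Get _ _ => 1
  | Op _ e1 e2 => 1 + depth e1 + depth e2
  | If e1 e2 e3 e4 => 1 + depth e1 + depth e2 + depth e3 + depth e4
  | Sum _ e => 1 + depth e
  end%nat.

(** Here [s] bounds both [n] and [m], hence the number of rounds of any loop. Each round of a [Sum]
    spends 5 steps besides its body; entering and leaving the loop takes the other 4. *)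
Fixpoint cost (s : nat) (e : rexp) : nat :=
  match e with
  | Num _ vs => 2 + length vs
  | Get _ vs => 6 + length vs
  | Op _ e1 e2 => 1 + cost s e1 + cost s e2
  | If e1 e2 e3 e4 => 2 + cost s e1 + cost s e2 + cost s e3 + cost s e4
  | Sum _ e => 4 + s * (5 + cost s e)
  end%nat.

(** The input as seen by compiled code: cells below [K] serve as scratch, so their original contents
    are looked up in the copy starting at [B]. *)
Definition view (K B : nat) (Rg : nat -> R) (q : nat) : R :=
  Rg (if Nat.ltb q K then (B + q)%nat else q).

(** Since [K <= B], no cell consulted by [view] lies below [K], and scratch writes cannot be seen
    through it. *)
Lemma view_ext K B Rg Rg' :
  (K <= B)%nat -> (forall q, (K <= q)%nat -> Rg' q = Rg q) ->
  forall q, view K B Rg' q = view K B Rg q.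
Proof.
  intros HB H q. unfold view. apply H. destruct (Nat.ltb_spec q K); lia.
Qed.

Lemma addr_updN N t v vs : forall c,
  (forall a, In a vs -> a <> t) -> addr (updN N t v) c vs = addr N c vs.
Proof.
  unfold addr. induction vs as [|a vs IH]; intros c H; simpl; [reflexivity|].
  rewrite updN_neq by (apply H; simpl; auto). apply IH. intros b Hb. apply H. now right.
Qed.

Lemma addr_code_correct P p t c vs N Rg :
  code_at P p (addr_code t c vs) -> (forall a, In a vs -> a <> t) ->
  exists N', reaches P (mkState p N Rg) (S (length vs))
               (mkState (p + length (addr_code t c vs)) N' Rg)
    /\ (forall a, a <> t -> N' a = N a) /\ N' t = addr N c vs.
Proof.
  intros [H0 H] Hv.
  assert (G : forall us p N, code_at P p (map (fun a => NAdd t t a) us) ->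
    (forall a, In a us -> a <> t) ->
    exists N', reaches P (mkState p N Rg) (length us) (mkState (p + length us) N' Rg)
      /\ (forall a, a <> t -> N' a = N a) /\ N' t = addr N (N t) us).
  { clear. induction us as [|a us IH]; intros p N H Hv; simpl in *.
    - exists N. rewrite Nat.add_0_r. split; [apply reaches_refl|auto].
    - destruct H as [H0 H].
      destruct (IH (S p) (updN N t (N t + N a)%nat) H) as [N' [E [F V]]]; [auto|].
      exists N'. split; [|split].
      + exec1 H0. replace (p + S (length us))%nat with (S p + length us)%nat by lia. exact E.
      + intros b Hb. rewrite F by assumption. now apply updN_neq.
      + rewrite V, updN_eq. apply addr_updN. auto. }
  destruct (G vs (S p) (updN N t c) H Hv) as [N' [E [F V]]].
  exists N'. split; [|split].
  - exec1 H0. unfold addr_code. simpl. rewrite length_map.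
    replace (p + S (length vs))%nat with (S p + length vs)%nat by lia. exact E.
  - intros a Ha. rewrite F by assumption. now apply updN_neq.
  - rewrite V, updN_eq. now apply addr_updN.
Qed.

Lemma length_visible l vs : (length (visible l vs) <= length vs)%nat.
Proof. apply filter_length_le. Qed.

Lemma visible_neq l vs a : In a (visible l vs) -> a <> l.
Proof. intros H. apply filter_In in H as [_ H]. apply Nat.ltb_lt in H. lia. Qed.

(** Induction on [e]. The two preservation clauses carry the induction: the value of a first operand
    in [r] survives the code of the second, which works from [S r] on, and by [eval_ext] the later
    subexpressions still have the values they had in the initial state. *)
Lemma comp_correct K s e : forall P p l r N Rg,
  code_at P p (comp K p l r e) -> (3 <= l)%nat -> (r + depth e <= K)%nat ->
  (K <= N 2)%nat -> (N 0 <= s)%nat -> (N 1 <= s)%nat ->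
  exists N' Rg',
    reaches P (mkState p N Rg) (cost s e) (mkState (p + length (comp K p l r e)) N' Rg')
    /\ (forall a, (a < l)%nat -> N' a = N a)
    /\ (forall q, (q < r)%nat \/ (K <= q)%nat -> Rg' q = Rg q)
    /\ Rg' r = eval (view K (N 2%nat) Rg) l N e.
Proof.
  induction e as [c vs|c vs|o e1 IH1 e2 IH2|e1 IH1 e2 IH2 e3 IH3 e4 IH4|b e IH];
    intros P p l r N Rg H Hl Hr HK Hn Hm; cbn [comp depth cost eval] in *.
  - apply code_at_app in H as [Ha [H0 _]].
    destruct (addr_code_correct P p l c _ N Rg Ha (visible_neq l vs)) as [N' [E [F V]]].
    exists N', (updR Rg r (INR (N' l))). split; [|split; [|split]].
    + rewrite length_app. simpl length at 2. eapply reaches_weaken.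
      * eapply reaches_trans; [exact E|]. exec1 H0. rewrite Nat.add_assoc, Nat.add_1_r.
        apply reaches_refl.
      * pose proof (length_visible l vs). lia.
    + intros a Hlt. apply F. lia.
    + intros q Hq. apply updR_neq. lia.
    + rewrite updR_eq, V. reflexivity.
  - apply code_at_app in H as [Ha H].
    destruct (addr_code_correct P p l c _ N Rg Ha (visible_neq l vs)) as [N' [E [F V]]].
    set (q := (p + length (addr_code l c (visible l vs)))%nat) in *.
    destruct H as [H0 [H1 [H2 [H3 [H4 _]]]]].
    pose proof (length_visible l vs) as Hlen.
    rewrite length_app, Nat.add_assoc. fold q. change (length (_ :: _)) with 5%nat.
    unfold view. rewrite <- V.
    (* An address below [K] is shifted into the copy by adding register 2; any other address is read
       directly. *)
    destruct (Nat.ltb_spec (N' l) K) as [Hlt|Hge].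
    + exists (updN (updN N' (S l) K) l (N' l + N' 2)%nat), (updR Rg r (Rg (N 2 + N' l)%nat)).
      split; [|split; [|split]].
      * eapply reaches_weaken.
        -- eapply reaches_trans; [exact E|]. exec1 H0. exec1 H1.
           rewrite updN_eq, updN_neq by lia. apply Nat.ltb_lt in Hlt as ->.
           exec1 H3. exec1 H4.
           rewrite updN_eq, !updN_neq, (F 2%nat), (Nat.add_comm (N' l)) by lia.
           replace (q + 5)%nat with (S (S (S (S (S q))))) by lia. apply reaches_refl.
        -- lia.
      * intros a Hal. rewrite !updN_neq by lia. apply F. lia.
      * intros k Hk. apply updR_neq. lia.
      * apply updR_eq.
    + exists (updN N' (S l) K), (updR Rg r (Rg (N' l))).
      split; [|split; [|split]].
      * eapply reaches_weaken.
        -- eapply reaches_trans; [exact E|]. exec1 H0. exec1 H1.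
           rewrite updN_eq, updN_neq by lia. apply Nat.ltb_ge in Hge as ->.
           exec1 H2. exec1 H4. rewrite updN_neq by lia.
           replace (q + 5)%nat with (S (S (S (S (S q))))) by lia. apply reaches_refl.
        -- lia.
      * intros a Hal. rewrite updN_neq by lia. apply F. lia.
      * intros k Hk. apply updR_neq. lia.
      * apply updR_eq.
  - apply code_at_app in H as [Hc1 H]. apply code_at_app in H as [Hc2 [H0 _]].
    destruct (IH1 _ _ _ _ N Rg Hc1) as [N1 [R1 [E1 [F1 [G1 V1]]]]]; try lia.
    destruct (IH2 _ _ _ _ N1 R1 Hc2) as [N2 [R2 [E2 [F2 [G2 V2]]]]];
      rewrite ?F1 by lia; try lia.
    exists N2, (updR R2 r (arith_fun o (R2 r) (R2 (S r)))). split; [|split; [|split]].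
    + rewrite !length_app. simpl length at 3. rewrite !Nat.add_assoc, Nat.add_1_r.
      eapply reaches_weaken.
      * eapply reaches_trans; [exact E1|]. eapply reaches_trans; [exact E2|].
        destruct o; exec1 H0; apply reaches_refl.
      * lia.
    + intros a Ha. rewrite F2, F1; auto.
    + intros q Hq. rewrite updR_neq, G2, G1 by lia. reflexivity.
    + rewrite updR_eq, G2, V1, V2, F1 by lia. f_equal. apply eval_ext; [lia| |exact F1].
      apply view_ext; [lia|]. intros; apply G1; lia.
  - apply code_at_app in H as [Hc1 H]. apply code_at_app in H as [Hc2 H].
    apply code_at_app in H as [[H0 _] H]. apply code_at_app in H as [Hc4 H].
    apply code_at_app in H as [[H1 _] Hc3].
    cbn [length] in *. rewrite ?Nat.add_1_r in *.
    set (c1 := comp K p l r e1) in *.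
    set (c2 := comp K (p + length c1) l (S r) e2) in *.
    set (q := (p + length c1 + length c2)%nat) in *.
    set (c4 := comp K (S q) l r e4) in *.
    set (c3 := comp K (S (S q + length c4)) l r e3) in *.
    destruct (IH1 _ _ _ _ N Rg Hc1) as [N1 [R1 [E1 [F1 [G1 V1]]]]]; try lia.
    destruct (IH2 _ _ _ _ N1 R1 Hc2) as [N2 [R2 [E2 [F2 [G2 V2]]]]];
      rewrite ?F1 by lia; try lia.
    fold c1 in E1. fold c1 in E2. fold c2 q in E2.
    assert (HF : forall a, (a < l)%nat -> N2 a = N a) by (intros; rewrite F2, F1; auto).
    assert (HG : forall k, (k < r)%nat \/ (K <= k)%nat -> R2 k = Rg k).
    { intros k Hk. rewrite G2, G1; [reflexivity|lia|lia]. }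
    assert (X : forall q, view K (N 2%nat) R1 q = view K (N 2%nat) Rg q).
    { apply view_ext; [lia|]. intros; apply G1; lia. }
    assert (X2 : forall q, view K (N 2%nat) R2 q = view K (N 2%nat) Rg q).
    { apply view_ext; [lia|]. intros; apply HG; lia. }
    rewrite F1 in V2 by lia.
    (* The test of the [If] is restated with the two registers that the machine compares. *)
    rewrite <- V1, <- (eval_ext _ _ e2 l N N1 ltac:(lia) X F1), <- V2, <- (G2 r) by lia.
    replace (p + length (c1 ++ _))%nat with (S (S q + length c4) + length c3)%nat
      by (rewrite !length_app; simpl length; unfold q; lia).
    (* This prefix is common to both branches. The code of [e4] directly follows the jump, and the
       code of [e3] comes after it. *)
    assert (J : reaches P (mkState p N Rg) (1 + cost s e1 + cost s e2)
      (mkState (if Rltb (R2 r) (R2 (S r)) then S (S q + length c4) else S q) N2 R2)).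
    { eapply reaches_weaken.
      - eapply reaches_trans; [exact E1|]. eapply reaches_trans; [exact E2|].
        exec1 H0. apply reaches_refl.
      - lia. }
    destruct (Rltb (R2 r) (R2 (S r))).
    + destruct (IH3 _ _ _ _ N2 R2 Hc3) as [N3 [R3 [E3 [F3 [G3 V3]]]]];
        rewrite ?HF by lia; try lia.
      exists N3, R3. split; [|split; [|split]].
      * eapply reaches_weaken; [eapply reaches_trans; [exact J|]|].
        -- exact E3.
        -- lia.
      * intros a Ha. rewrite F3, HF; auto.
      * intros k Hk. rewrite G3, HG; auto.
      * rewrite V3, HF by lia. apply eval_ext; [lia|exact X2|exact HF].
    + destruct (IH4 _ _ _ _ N2 R2 Hc4) as [N3 [R3 [E3 [F3 [G3 V3]]]]];
        rewrite ?HF by lia; try lia.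
      exists N3, R3. split; [|split; [|split]].
      * eapply reaches_weaken; [eapply reaches_trans; [exact J|]|].
        -- eapply reaches_trans; [exact E3|]. fold c4. exec1 H1. apply reaches_refl.
        -- lia.
      * intros a Ha. rewrite F3, HF; auto.
      * intros k Hk. rewrite G3, HG; auto.
      * rewrite V3, HF by lia. apply eval_ext; [lia|exact X2|exact HF].
  - set (c := comp K (4 + p) (S l) (S r) e) in *.
    apply code_at_app in H as [[H0 [H1 [H2 [H3 _]]]] H].
    apply code_at_app in H as [Hc [H4 [H5 [H6 [H7 _]]]]].
    cbn [length] in *. rewrite (Nat.add_comm p 4) in *.
    set (g := fun i => eval (view K (N 2%nat) Rg) (S l) (updN N l i) e).
    set (cnt := N (bound_reg b)).
    assert (Hcnt : (cnt <= s)%nat) by (unfold cnt; destruct b; simpl; lia).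
    assert (Hb : (bound_reg b < 2)%nat) by (destruct b; simpl; lia).
    (* Loop invariant at the test: after [i] rounds register [l] holds [i] and real register [r]
       holds the partial sum, while the body works from [S l] and [S r] on. *)
    assert (Loop : forall i, (i <= cnt)%nat -> exists N' Rg',
      reaches P (mkState p N Rg) (2 + i * (5 + cost s e)) (mkState (2 + p) N' Rg')
      /\ (forall a, (a < l)%nat -> N' a = N a) /\ N' l = i
      /\ (forall q, (q < r)%nat \/ (K <= q)%nat -> Rg' q = Rg q)
      /\ Rg' r = rsum (map g (seq 0 i))).
    { induction i as [|i IHi]; intros Hi.
      - exists (updN N l 0), (updR Rg r 0). split; [|split; [|split; [|split]]].
        + exec1 H0. exec1 H1. rewrite updN_eq. apply reaches_refl.
        + intros a Ha. apply updN_neq. lia.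
        + apply updN_eq.
        + intros q Hq. apply updR_neq. lia.
        + apply updR_eq.
      - destruct IHi as [N1 [R1 [E1 [F1 [L1 [G1 V1]]]]]]; [lia|].
        destruct (IH _ _ _ _ N1 R1 Hc) as [N2 [R2 [E2 [F2 [G2 V2]]]]];
          rewrite ?F1 by lia; try lia.
        exists (updN (updN N2 (S l) 1) l (S i)), (updR R2 r (R2 r + R2 (S r))).
        split; [|split; [|split; [|split]]].
        + eapply reaches_weaken.
          * eapply reaches_trans; [exact E1|]. exec1 H2.
            rewrite L1, F1 by lia. fold cnt.
            destruct (Nat.ltb_spec i cnt); [|lia].
            eapply reaches_trans; [exact E2|]. fold c.
            exec1 H4. exec1 H5. exec1 H6. exec1 H7.
            rewrite updN_eq, updN_neq, F2, L1, Nat.add_1_r by lia. apply reaches_refl.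
          * lia.
        + intros a Ha. rewrite !updN_neq, F2, F1 by lia. reflexivity.
        + apply updN_eq.
        + intros q Hq. rewrite updR_neq, G2, G1 by lia. reflexivity.
        + rewrite updR_eq, seq_S, map_app. cbn [map].
          rewrite rsum_snoc, G2, V1, V2, F1 by lia.
          f_equal. unfold g. apply eval_ext; [lia| |].
          * apply view_ext; [lia|]. intros; apply G1; lia.
          * intros a Ha. unfold updN. destruct (Nat.eqb_spec a l); [now subst|].
            apply F1; lia. }
    destruct (Loop cnt (Nat.le_refl _)) as [N1 [R1 [E1 [F1 [L1 [G1 V1]]]]]].
    exists N1, R1. split; [|split; [|split]]; auto.
    eapply reaches_weaken.
    + eapply reaches_trans; [exact E1|]. exec1 H2. rewrite L1, F1 by lia. fold cnt.
      rewrite Nat.ltb_irrefl. exec1 H3. rewrite !length_app. simpl length.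
      replace (p + (4 + (length c + 4)))%nat with (8 + p + length c)%nat by lia.
      apply reaches_refl.
    + nia.
Qed.

(** * Polynomial growth of the running time *)

Definition poly_bounded (g : nat -> nat) : Prop :=
  exists c k, forall s, (1 <= s)%nat -> (g s <= c * s ^ k)%nat.

Lemma poly_bounded_const a : poly_bounded (fun _ => a).
Proof. exists a, 0%nat. intros; simpl; lia. Qed.

Lemma poly_bounded_id : poly_bounded (fun s => s).
Proof. exists 1%nat, 1%nat. intros; simpl; lia. Qed.

(** For [1 <= s] every power of [s] is at least 1, so both terms are dominated by the power with the
    exponents added. *)
Lemma poly_bounded_add g h :
  poly_bounded g -> poly_bounded h -> poly_bounded (fun s => g s + h s)%nat.
Proof.
  intros [c1 [k1 H1]] [c2 [k2 H2]]. exists (c1 + c2)%nat, (k1 + k2)%nat. intros s Hs.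
  specialize (H1 s Hs). specialize (H2 s Hs). rewrite Nat.pow_add_r.
  assert (1 <= s ^ k1)%nat by (apply Nat.neq_0_lt_0, Nat.pow_nonzero; lia).
  assert (1 <= s ^ k2)%nat by (apply Nat.neq_0_lt_0, Nat.pow_nonzero; lia).
  nia.
Qed.

Lemma poly_bounded_mul g h :
  poly_bounded g -> poly_bounded h -> poly_bounded (fun s => g s * h s)%nat.
Proof.
  intros [c1 [k1 H1]] [c2 [k2 H2]]. exists (c1 * c2)%nat, (k1 + k2)%nat. intros s Hs.
  rewrite Nat.pow_add_r, Nat.mul_shuffle1. apply Nat.mul_le_mono; auto.
Qed.

(** For a fixed expression, [cost] is built from [s] and constants by sums and products. The
    exponent depends on the expression, which for the search below is determined by [d] alone. *)
Lemma poly_bounded_cost e : poly_bounded (fun s => cost s e).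
Proof.
  induction e; cbn [cost];
    repeat first [assumption | apply poly_bounded_const | apply poly_bounded_id
                 | apply poly_bounded_add | apply poly_bounded_mul].
Qed.

(** * The whole program: saving input cells, evaluation and final test *)

Definition save_code (K : nat) : list instr :=
  flat_map (fun i => addr_code 3 i [2%nat] ++ [RStore 3 i]) (seq 0 K).

(** The copies are written from address [N 2] on; as [K <= N 2], they never overwrite a cell that is
    still to be copied. *)
Lemma save_code_correct P p K N Rg :
  code_at P p (save_code K) -> (K <= N 2)%nat ->
  exists N' Rg',
    reaches P (mkState p N Rg) (3 * K) (mkState (p + length (save_code K)) N' Rg')
    /\ (forall a, a <> 3%nat -> N' a = N a)
    /\ (forall q, (q < N 2)%nat -> Rg' q = Rg q)
    /\ (forall q, (q < K)%nat -> Rg' (N 2 + q)%nat = Rg q).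
Proof.
  unfold save_code. induction K as [|K IH]; intros H HK.
  - exists N, Rg. rewrite Nat.add_0_r. split; [apply reaches_refl|]. repeat split; auto; lia.
  - rewrite seq_S, flat_map_app in *. apply code_at_app in H as [H1 H2].
    destruct IH as [N1 [R1 [E1 [F1 [G1 V1]]]]]; [exact H1|lia|].
    cbn [flat_map Nat.add] in *. rewrite app_nil_r in *. apply code_at_app in H2 as [Ha [H2 _]].
    destruct (addr_code_correct P _ 3 K [2%nat] N1 R1 Ha) as [N2 [E2 [F2 V2]]].
    { simpl. intros a Hin. destruct Hin as [<-|[]]. lia. }
    exists N2, (updR R1 (N2 3%nat) (R1 K)).
    assert (V : N2 3%nat = (N 2 + K)%nat).
    { rewrite V2. unfold addr; simpl. rewrite F1 by lia. lia. }
    split; [|split; [|split]].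
    + eapply reaches_weaken.
      * eapply reaches_trans; [exact E1|]. eapply reaches_trans; [exact E2|]. exec1 H2.
        rewrite !length_app. cbn [length]. rewrite Nat.add_assoc, Nat.add_assoc, Nat.add_1_r.
        apply reaches_refl.
      * simpl. lia.
    + intros a Ha3. rewrite F2, F1 by assumption. reflexivity.
    + intros q Hq. rewrite updR_neq by lia. auto.
    + intros q Hq. destruct (Nat.eq_dec q K) as [->|Hne].
      * rewrite V, updR_eq. apply G1. lia.
      * rewrite updR_neq by lia. apply V1. lia.
Qed.

(* The input is left untouched below [B = K + 1 + n d + m d + n], and its first [K]
   cells are copied to [B, B + K), so that registers below [K] become available. *)
Definition program (d : nat) (e : rexp) : list instr :=
  let K := depth e in
  let c1 := addr_code 2 (K + 1) (repeat 0%nat d ++ repeat 1%nat d ++ [0%nat]) in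
  let c2 := save_code K in
  let p := (length c1 + length c2)%nat in
  let c3 := comp K p 3 0 e in
  let q := (p + length c3)%nat in
  c1 ++ c2 ++ c3 ++
    [NConst 3 0; RFromN 1 3; JLtR 1 0 (5 + q); NConst 0 0; Halt; NConst 0 1; Halt].

Lemma addr_app env c vs ws : addr env c (vs ++ ws) = addr env (addr env c vs) ws.
Proof. apply fold_left_app. Qed.

(** The machine has no product of naturals. Repeating a register [d] times in an address list yields
    the multiples of [d] that the input encoding calls for. *)
Lemma addr_repeat env a j : forall c, addr env c (repeat a j) = (c + env a * j)%nat.
Proof.
  unfold addr. induction j as [|j IH]; intros c; simpl; [lia|]. rewrite IH. lia.
Qed.

(** The input function [inp] is pinned down on the input cells only, because copying may have
    changed what lies beyond them. The constants [c] and [k] are chosen before [n] and [m]. *)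
Theorem program_correct d e :
  exists c k, forall n m N Rg, N 0%nat = n -> N 1%nat = m ->
  exists t s inp env,
    (t <= c * (n + m + 1) ^ k)%nat /\
    steps (program d e) (mkState 0 N Rg) t = Some s /\ halted (program d e) s /\
    (forall q, (q < 1 + n * d + m * d + n)%nat -> inp q = Rg q) /\
    env 0%nat = n /\ env 1%nat = m /\
    (Nreg s 0%nat <> 0%nat <-> 0 < eval inp 3 env e).
Proof.
  set (K := depth e).
  set (vs := repeat 0%nat d ++ repeat 1%nat d ++ [0%nat]).
  (* The constant part pays for computing the base address of the copy, for 3 instructions per saved
     cell and for the final test. *)
  destruct (poly_bounded_add _ _ (poly_bounded_const (S (length vs) + (3 * K + 5)))
              (poly_bounded_cost e)) as [c [k Hck]].
  exists c, k. intros n m N Rg Hn Hm.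
  set (P := program d e).
  set (c1 := addr_code 2 (K + 1) vs).
  set (c2 := save_code K).
  set (p := (length c1 + length c2)%nat).
  set (c3 := comp K p 3 0 e).
  set (q := (p + length c3)%nat).
  (* The program is viewed as a fragment of itself and then cut into its four pieces. *)
  assert (HP : code_at P 0 P).
  { pose proof (code_at_infix [] P []) as H. now rewrite app_nil_r in H. }
  unfold P in HP at 2. unfold program in HP. fold K vs c1 c2 p c3 q in HP.
  apply code_at_app in HP as [H1 HP]. apply code_at_app in HP as [H2 HP].
  apply code_at_app in HP as [H3 HP]. cbn [Nat.add] in H1, H2, H3, HP.
  fold p in H3, HP. fold q in HP.
  destruct HP as [I0 [I1 [I2 [I3 [I4 [I5 [I6 _]]]]]]].
  destruct (addr_code_correct P 0 2 (K + 1) vs N Rg H1) as [N1 [E1 [F1 V1]]].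
  { unfold vs. intros a Ha. rewrite !in_app_iff in Ha.
    destruct Ha as [Ha|[Ha|[<-|[]]]]; [apply repeat_spec in Ha|apply repeat_spec in Ha|]; lia. }
  assert (VB : N1 2%nat = (K + 1 + n * d + m * d + n)%nat).
  { rewrite V1. unfold vs. rewrite !addr_app, !addr_repeat, Hn, Hm. unfold addr; simpl.
    rewrite Hn. lia. }
  destruct (save_code_correct P (length c1) K N1 Rg H2) as [N2 [R2 [E2 [F2 [G2 V2]]]]]; [lia|].
  assert (B0 : N2 0%nat = n) by (rewrite F2, F1 by lia; assumption).
  assert (B1 : N2 1%nat = m) by (rewrite F2, F1 by lia; assumption).
  assert (B2 : N2 2%nat = (K + 1 + n * d + m * d + n)%nat) by (rewrite F2; lia).
  destruct (comp_correct K (n + m + 1) e P p 3 0 N2 R2 H3)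
    as [N3 [R3 [E3 [F3 [G3 V3]]]]]; try lia.
  fold c3 q in E3.
  assert (E : reaches P (mkState 0 N Rg) (S (length vs) + (3 * K + (cost (n + m + 1) e + 3)))
    (mkState (if Rltb 0 (R3 0%nat) then (5 + q)%nat else S (S (S q)))
       (updN N3 3 0) (updR R3 1 0))).
  { eapply reaches_weaken.
    - eapply reaches_trans; [exact E1|]. eapply reaches_trans; [exact E2|].
      eapply reaches_trans; [exact E3|]. exec1 I0. exec1 I1. exec1 I2.
      rewrite updN_eq. apply reaches_refl.
    - lia. }
  assert (Out : exists s, reaches P (mkState 0 N Rg)
      (S (length vs) + (3 * K + 5) + cost (n + m + 1) e) s
    /\ halted P s /\ (Nreg s 0%nat <> 0%nat <-> 0 < R3 0%nat)).
  { unfold Rltb in E. destruct (Rlt_dec 0 (R3 0%nat)) as [Hpos|Hpos].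
    - exists (mkState (6 + q) (updN (updN N3 3 0) 0 1) (updR R3 1 0)). split; [|split].
      + eapply reaches_weaken; [eapply reaches_trans; [exact E|]|].
        * exec1 I5. apply reaches_refl.
        * lia.
      + unfold halted, step. cbn [pc Nat.add]. rewrite I6. reflexivity.
      + simpl. split; [intros _; exact Hpos|intros _; discriminate].
    - exists (mkState (4 + q) (updN (updN N3 3 0) 0 0) (updR R3 1 0)). split; [|split].
      + eapply reaches_weaken; [eapply reaches_trans; [exact E|]|].
        * exec1 I3. apply reaches_refl.
        * lia.
      + unfold halted, step. cbn [pc Nat.add]. rewrite I4. reflexivity.
      + simpl. split; [intros []; reflexivity|intros; contradiction]. }
  destruct Out as [s [[t [Ht Es]] [Hh Ho]]].
  exists t, s, (view K (N2 2%nat) R2), N2.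
  split; [|split; [exact Es|split; [exact Hh|split; [|split; [exact B0|split; [exact B1|]]]]]].
  - specialize (Hck (n + m + 1)%nat). lia.
  - intros a Ha. unfold view. destruct (Nat.ltb_spec a K).
    + rewrite F2 by lia. auto.
    + apply G2. lia.
  - rewrite Ho, V3. reflexivity.
Qed.

(** * The search expression *)

(* Expressions are written as functions of the level at which they are placed, so that
   they can be duplicated under further sums. *)
Definition lexp : Type := nat -> rexp.

Definition num (c : nat) (vs : list nat) : lexp := fun _ => Num c vs.
Definition get (c : nat) (vs : list nat) : lexp := fun _ => Get c vs.
Definition op (o : arith) (E F : lexp) : lexp := fun l => Op o (E l) (F l).
Definition cond (E1 E2 E3 E4 : lexp) : lexp := fun l => If (E1 l) (E2 l) (E3 l) (E4 l).
(** The bound register is the level itself and the body is placed one level higher, so nested sums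
    use distinct registers. *)
Definition sum (b : bool) (F : nat -> lexp) : lexp := fun l => Sum b (F l (S l)).

Definition zero : lexp := num 0 [].
Definition one : lexp := num 1 [].
Definition absE (E : lexp) : lexp := cond E zero (op Sub zero E) E.
Definition maxE (E F : lexp) : lexp := cond F E E F.
(** Sums over candidates start at index 0, which is the target; this guard leaves only the
    rivals. *)
Definition if_pos (i : nat) (E : lexp) : lexp := cond zero (num 0 [i]) E zero.

Definition epsE : lexp := get 0 [].
Definition targetE (k : nat) : lexp := get (1 + k) [].
Definition candE (d i k : nat) : lexp := get (1 + k) (repeat i d).
Definition voterE (d v k : nat) : lexp := get (1 + k) (repeat 0%nat d ++ repeat v d).
Definition ruleE (d t : nat) : lexp := get 1 (repeat 0%nat d ++ repeat 1%nat d ++ [t]).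

Definition distE (d : nat) (x : nat -> lexp) (v : nat) : lexp :=
  fold_right maxE zero (map (fun k => absE (op Sub (x k) (voterE d v k))) (seq 0 d)).

Definition rank_targetE (d : nat) (x : nat -> lexp) (v : nat) : lexp :=
  op Add one
    (sum false (fun i => if_pos i (cond (distE d x v) (distE d (candE d i) v) zero one))).

Definition rank_otherE (d : nat) (x : nat -> lexp) (v j : nat) : lexp :=
  op Add
    (op Add one
      (sum false (fun i =>
        if_pos i (cond (distE d (candE d i) v) (distE d (candE d j) v) one zero))))
    (cond (distE d x v) (distE d (candE d j) v) one zero).

(* A real cannot be used as an address, so [f rank] is found by scanning all of [f]. *)
Definition awardE (d : nat) (rk : lexp) : lexp :=
  sum false (fun t =>
    cond rk (num 1 [t]) zero (cond (num 1 [t]) rk zero (ruleE d t))).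

Definition score_targetE (d : nat) (x : nat -> lexp) : lexp :=
  sum true (fun v => awardE d (rank_targetE d x v)).

Definition score_otherE (d : nat) (x : nat -> lexp) (j : nat) : lexp :=
  sum true (fun v => awardE d (rank_otherE d x v j)).

Definition checkE (d : nat) (x : nat -> lexp) : lexp :=
  fold_right (fun k E => cond epsE (absE (op Sub (x k) (targetE k))) zero E)
    (sum false (fun j => if_pos j (cond (score_otherE d x j) (score_targetE d x) zero one)))
    (seq 0 d).

(** An existential quantifier over the break points of coordinate [k], rendered as a sum of
    nonnegative values. The four copies of [F] cost a constant factor in size, harmless for fixed
    [d]. *)
Definition sum_breaks (d k : nat) (F : lexp -> lexp) : lexp :=
  op Add
    (op Add (F (op Sub (targetE k) epsE)) (F (op Add (targetE k) epsE)))
    (sum true (fun v => sum false (fun i =>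
      op Add (F (op Sub (voterE d v k) (distE d (candE d i) v)))
             (F (op Add (voterE d v k) (distE d (candE d i) v)))))).

(** Two break points are chosen per coordinate, so [(2 + 2nm)^(2d)] combinations are tried in
    all. *)
Fixpoint searchE (d rem : nat) (x : nat -> lexp) : lexp :=
  match rem with
  | O => checkE d x
  | S k =>
      sum_breaks d k (fun b => sum_breaks d k (fun b' =>
        searchE d k
          (fun a => if Nat.eqb a k then op Div (op Add b b') (num 2 []) else x a)))
  end.

(** * Meaning of level-dependent expressions *)

Definition extends (l : nat) (env : nat -> nat) (l' : nat) (env' : nat -> nat) : Prop :=
  (l <= l')%nat /\ forall a, (a < l)%nat -> env' a = env a.

Definition var (l : nat) (env : nat -> nat) (a i : nat) : Prop := (a < l)%nat /\ env a = i.

(** Quantifying over all extensions makes the property stable when the expression is reused under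
    further sums. *)
Definition sat (inp : nat -> R) (l : nat) (env : nat -> nat) (E : lexp) (Phi : R -> Prop) :=
  forall l' env', extends l env l' env' -> Phi (eval inp l' env' (E l')).

Definition means inp l env E (r : R) : Prop := sat inp l env E (fun y => y = r).

(** Nonnegativity excludes cancellation, so that addition acts as disjunction and [sum] as an
    existential quantifier. *)
Definition indicates inp l env E (Q : Prop) : Prop :=
  sat inp l env E (fun y => 0 <= y /\ (0 < y <-> Q)).

Lemma extends_refl l env : extends l env l env.
Proof. split; auto. Qed.

Lemma extends_trans l env l1 env1 l2 env2 :
  extends l env l1 env1 -> extends l1 env1 l2 env2 -> extends l env l2 env2.
Proof. intros [H1 E1] [H2 E2]; split; [lia|]. intros a Ha. rewrite E2, E1; auto; lia. Qed.

Lemma var_extends l env l' env' a i : extends l env l' env' -> var l env a i -> var l' env' a i.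
Proof. intros [H E] [Ha V]; split; [lia|]. rewrite E; auto. Qed.

Lemma sat_extends inp l env l' env' E Phi :
  extends l env l' env' -> sat inp l env E Phi -> sat inp l' env' E Phi.
Proof. intros X H l2 env2 X2. apply H. eapply extends_trans; eauto. Qed.

Lemma sat_impl inp l env E (Phi Psi : R -> Prop) :
  (forall y, Phi y -> Psi y) -> sat inp l env E Phi -> sat inp l env E Psi.
Proof. intros H X l' env' Y. auto. Qed.

Lemma means_eq inp l env E r r' : means inp l env E r -> r = r' -> means inp l env E r'.
Proof. now intros H <-. Qed.

Lemma visible_addr l env c vs :
  (forall a, In a vs -> (a < l)%nat) -> addr env c (visible l vs) = addr env c vs.
Proof.
  intros H. unfold visible. f_equal. rewrite forallb_filter_id; [reflexivity|].
  apply forallb_forall. intros a Ha. apply Nat.ltb_lt; auto.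
Qed.

Lemma addr_extends l env l' env' c vs :
  (forall a, In a vs -> (a < l)%nat) -> extends l env l' env' ->
  addr env' c (visible l' vs) = addr env c vs.
Proof.
  intros H [Hl E]. rewrite visible_addr by (intros a Ha; specialize (H a Ha); lia).
  rewrite <- (visible_addr l env), <- (visible_addr l env' c vs) by assumption.
  now apply addr_ext.
Qed.

Lemma means_num inp l env c vs :
  (forall a, In a vs -> (a < l)%nat) -> means inp l env (num c vs) (INR (addr env c vs)).
Proof. intros H l' env' X. simpl. now rewrite (addr_extends l env). Qed.

Lemma means_get inp l env c vs r :
  (forall a, In a vs -> (a < l)%nat) -> inp (addr env c vs) = r ->
  means inp l env (get c vs) r.
Proof. intros H <- l' env' X. simpl. now rewrite (addr_extends l env). Qed.

Lemma means_const inp l env c : means inp l env (num c []) (INR c).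
Proof. apply (means_num inp l env c []). intros a []. Qed.

Lemma means_index inp l env c a i :
  var l env a i -> means inp l env (num c [a]) (INR (c + i)).
Proof.
  intros [H <-]. apply (means_num inp l env c [a]). intros b [<-|[]]. exact H.
Qed.

Lemma means_op inp l env o E F r r' :
  means inp l env E r -> means inp l env F r' ->
  means inp l env (op o E F) (arith_fun o r r').
Proof. intros H H' l' env' X. simpl. now rewrite (H l' env' X), (H' l' env' X). Qed.

Lemma sat_cond inp l env E1 E2 E3 E4 r1 r2 Phi :
  means inp l env E1 r1 -> means inp l env E2 r2 ->
  (r1 < r2 -> sat inp l env E3 Phi) -> (~ r1 < r2 -> sat inp l env E4 Phi) ->
  sat inp l env (cond E1 E2 E3 E4) Phi.
Proof.
  intros H1 H2 H3 H4 l' env' X. simpl. rewrite (H1 l' env' X), (H2 l' env' X).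
  unfold Rltb. destruct (Rlt_dec r1 r2); [apply H3|apply H4]; auto.
Qed.

Lemma extends_updN l env i : extends l env (S l) (updN env l i).
Proof. split; [lia|]. intros a Ha. apply updN_neq. lia. Qed.

Lemma var_updN l env i : var (S l) (updN env l i) l i.
Proof. split; [lia|apply updN_eq]. Qed.

Lemma means_sum inp l env b F cnt g :
  var l env (bound_reg b) cnt ->
  (forall i a l' env', (i < cnt)%nat -> extends l env l' env' -> var l' env' a i ->
     means inp l' env' (F a) (g i)) ->
  means inp l env (sum b F) (rsum (map g (seq 0 cnt))).
Proof.
  intros V H l' env' X. destruct (var_extends _ _ _ _ _ _ X V) as [_ Hc].
  simpl. rewrite Hc. f_equal. apply map_ext_in. intros i Hi. apply in_seq in Hi.
  eapply H; [lia| |apply var_updN|apply extends_refl].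
  eapply extends_trans; [exact X|apply extends_updN].
Qed.

Lemma rsum_pos xs :
  (forall y, In y xs -> 0 <= y) -> 0 <= rsum xs /\ (0 < rsum xs <-> exists y, In y xs /\ 0 < y).
Proof.
  induction xs as [|x xs IH]; intros H; simpl.
  - split; [lra|]. split; [lra|]. intros [y [[] _]].
  - destruct IH as [IH0 IH1]; [intros; apply H; now right|].
    assert (0 <= x) by (apply H; now left). split; [lra|]. split.
    + intros Hs. destruct (Rlt_dec 0 x); [exists x; auto|].
      destruct IH1 as [IH1 _]. destruct IH1 as [y [Hy Py]]; [lra|]. exists y; auto.
    + intros [y [[<-|Hy] Py]]; [lra|]. assert (0 < rsum xs) by (apply IH1; eauto). lra.
Qed.

Lemma indicates_sum inp l env b F cnt (Q : nat -> Prop) :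
  var l env (bound_reg b) cnt ->
  (forall i a l' env', (i < cnt)%nat -> extends l env l' env' -> var l' env' a i ->
     indicates inp l' env' (F a) (Q i)) ->
  indicates inp l env (sum b F) (exists i, (i < cnt)%nat /\ Q i).
Proof.
  intros V H l' env' X. destruct (var_extends _ _ _ _ _ _ X V) as [_ Hc].
  simpl. rewrite Hc.
  set (g := fun i => eval inp (S l') (updN env' l' i) (F l' (S l'))).
  assert (G : forall i, (i < cnt)%nat -> 0 <= g i /\ (0 < g i <-> Q i)).
  { intros i Hi. eapply H; [exact Hi| |apply var_updN|apply extends_refl].
    eapply extends_trans; [exact X|apply extends_updN]. }
  destruct (rsum_pos (map g (seq 0 cnt))) as [H0 H1].
  { intros y Hy. apply in_map_iff in Hy as [i [<- Hi]]. apply in_seq in Hi. apply G; lia. }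
  split; [exact H0|]. rewrite H1. split.
  - intros [y [Hy Py]]. apply in_map_iff in Hy as [i [<- Hi]]. apply in_seq in Hi.
    exists i; split; [lia|]. apply G; [lia|exact Py].
  - intros [i [Hi HQ]]. exists (g i). split; [|apply G; auto].
    apply in_map, in_seq. lia.
Qed.

Lemma indicates_add inp l env E F (P Q : Prop) :
  indicates inp l env E P -> indicates inp l env F Q ->
  indicates inp l env (op Add E F) (P \/ Q).
Proof.
  intros H H' l' env' X. simpl. destruct (H l' env' X) as [A <-], (H' l' env' X) as [B <-].
  split; [lra|]. split; [|lra].
  intros ?. destruct (Rlt_dec 0 (eval inp l' env' (E l'))); [now left|right; lra].
Qed.

Lemma indicates_iff inp l env E (P Q : Prop) :
  indicates inp l env E P -> (P <-> Q) -> indicates inp l env E Q.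
Proof. intros H HPQ l' env' X. rewrite <- HPQ. now apply H. Qed.

Lemma indicates_of_means inp l env E r (Q : Prop) :
  means inp l env E r -> 0 <= r -> (0 < r <-> Q) -> indicates inp l env E Q.
Proof. intros H A B. eapply sat_impl; [|exact H]. intros y ->. auto. Qed.

Lemma means_zero inp l env : means inp l env zero 0.
Proof. exact (means_const inp l env 0). Qed.

Lemma means_one inp l env : means inp l env one 1.
Proof. exact (means_const inp l env 1). Qed.

Lemma means_abs inp l env E r : means inp l env E r -> means inp l env (absE E) (Rabs r).
Proof.
  intros H. eapply sat_cond; [exact H|apply means_zero| |]; intros Hr.
  - eapply means_eq; [apply means_op; [apply means_zero|exact H]|].
    simpl. rewrite Rabs_left by assumption. lra.
  - eapply means_eq; [exact H|]. rewrite Rabs_right by lra. reflexivity.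
Qed.

Lemma means_max inp l env E F r r' :
  means inp l env E r -> means inp l env F r' -> means inp l env (maxE E F) (Rmax r r').
Proof.
  intros H H'. eapply sat_cond; [exact H'|exact H| |]; intros Hr.
  - rewrite Rmax_left by lra. exact H.
  - rewrite Rmax_right by lra. exact H'.
Qed.

Lemma sat_if_pos inp l env a i E (Phi : R -> Prop) :
  var l env a i -> ((0 < i)%nat -> sat inp l env E Phi) -> (i = 0%nat -> Phi 0) ->
  sat inp l env (if_pos a E) Phi.
Proof.
  intros V H H0. eapply sat_cond; [apply means_zero|exact (means_index inp l env 0 a i V)| |];
    simpl; intros Hi.
  - apply H. apply INR_lt. exact Hi.
  - eapply sat_impl; [|apply means_zero]. intros y ->. apply H0.
    destruct i; [reflexivity|]. exfalso. apply Hi. apply (lt_INR 0). lia.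
Qed.

(** * Correctness of the search *)

Definition breaks (d n m : nat) (C V : nat -> nat -> R) (eps : R) (k : nat) : list R :=
  [C 0%nat k - eps; C 0%nat k + eps] ++
  flat_map (fun v => flat_map (fun i =>
    [V v k - dinf d (C i) (V v); V v k + dinf d (C i) (V v)]) (seq 0 n)) (seq 0 m).

Lemma in_breaks d n m C V eps k b :
  In b (breaks d n m C V eps k) <->
  (b = C 0%nat k - eps \/ b = C 0%nat k + eps) \/
  exists v, (v < m)%nat /\ exists i, (i < n)%nat /\
    (b = V v k - dinf d (C i) (V v) \/ b = V v k + dinf d (C i) (V v)).
Proof.
  unfold breaks. rewrite in_app_iff, in_flat_map. split.
  - intros [[<-|[<-|[]]]|[v [Hv Hb]]]; auto.
    right. apply in_flat_map in Hb as [i [Hi Hb]]. apply in_seq in Hv, Hi.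
    exists v; split; [lia|]. exists i; split; [lia|].
    destruct Hb as [<-|[<-|[]]]; auto.
  - intros [[->| ->]|[v [Hv [i [Hi Hb]]]]]; [left; simpl; auto..|].
    right. exists v. split; [apply in_seq; lia|]. apply in_flat_map. exists i.
    split; [apply in_seq; lia|]. destruct Hb as [->| ->]; simpl; auto.
Qed.

Definition beats (d n m : nat) (C V : nat -> nat -> R) (f : nat -> R) (eps : R)
  (x : nat -> R) : Prop :=
  (forall k, (k < d)%nat -> Rabs (x k - C 0%nat k) <= eps) /\
  exists j, (1 <= j < n)%nat /\ score_other d n m C V f x j >= score_target d n m C V f x.

Fixpoint search (d n m : nat) (C V : nat -> nat -> R) (f : nat -> R) (eps : R)
  (rem : nat) (x : nat -> R) : Prop :=
  match rem with
  | O => beats d n m C V f eps x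
  | S k =>
      exists b, In b (breaks d n m C V eps k) /\
      exists b', In b' (breaks d n m C V eps k) /\
      search d n m C V f eps k (updR x k ((b + b') / 2))
  end.

Lemma rsum_indicator (p : nat -> bool) xs :
  rsum (map (fun i => if p i then 1 else 0) xs) = INR (length (filter p xs)).
Proof.
  induction xs as [|x xs IH]; [reflexivity|].
  cbn [map rsum fold_right filter]. change (fold_right Rplus 0) with rsum.
  rewrite IH. destruct (p x); [cbn [length]; rewrite S_INR|]; lra.
Qed.

Lemma rsum_indicator_pos (p : nat -> bool) n :
  (0 < n)%nat ->
  rsum (map (fun i => if Nat.ltb 0 i && p i then 1 else 0) (seq 0 n))
    = INR (length (filter p (seq 1 (n - 1)))).
Proof.
  intros Hn. rewrite rsum_indicator. destruct n as [|n]; [lia|].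
  simpl. rewrite Nat.sub_0_r. do 2 f_equal. apply filter_ext_in.
  intros i Hi. apply in_seq in Hi. destruct i; [lia|reflexivity].
Qed.

(** One term survives; this is why the scan performed by [awardE] returns a single entry of the
    scoring rule. *)
Lemma rsum_single (g : nat -> R) t : forall a n,
  (a <= t < a + n)%nat ->
  rsum (map (fun i => if Nat.eqb i t then g i else 0) (seq a n)) = g t.
Proof.
  assert (Z : forall n a, (t < a)%nat ->
    rsum (map (fun i => if Nat.eqb i t then g i else 0) (seq a n)) = 0).
  { induction n as [|n IH]; intros a Ha; [reflexivity|].
    cbn [seq map rsum fold_right]. change (fold_right Rplus 0) with rsum.
    rewrite IH by lia. destruct (Nat.eqb_spec a t); [lia|lra]. }
  intros a n; revert a. induction n as [|n IH]; intros a Ha; [lia|].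
  cbn [seq map rsum fold_right]. change (fold_right Rplus 0) with rsum.
  destruct (Nat.eqb_spec a t) as [->|Hne].
  - rewrite Z by lia. lra.
  - rewrite IH by lia. lra.
Qed.

Lemma filter_length_lt {A} (p : A -> bool) x xs :
  In x xs -> p x = false -> (length (filter p xs) < length xs)%nat.
Proof.
  induction xs as [|y xs IH]; intros H Hp; [destruct H|].
  simpl. destruct H as [->|H].
  - rewrite Hp. pose proof (filter_length_le p xs). lia.
  - specialize (IH H Hp). destruct (p y); simpl; lia.
Qed.

(** * Meaning of the search expression on an encoded instance *)

Section Instance.
Context (d n m : nat) (C V : nat -> nat -> R) (f : nat -> R) (eps : R) (inp : nat -> R).
Context (n_pos : (0 < n)%nat).
Context (inp_init : forall q, (q < 1 + n * d + m * d + n)%nat ->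
  inp q = Rreg (init_state d n m C V f eps) q).

Definition in_context (l : nat) (env : nat -> nat) : Prop := var l env 0 n /\ var l env 1 m.

Lemma in_context_extends l env l' env' :
  extends l env l' env' -> in_context l env -> in_context l' env'.
Proof. intros X [A B]; split; eapply var_extends; eauto. Qed.

Lemma inp_eps : inp 0%nat = eps.
Proof. rewrite inp_init by lia. reflexivity. Qed.

Lemma inp_cand i k : (i < n)%nat -> (k < d)%nat -> inp (1 + k + i * d)%nat = C i k.
Proof.
  intros Hi Hk. assert (k + i * d < n * d)%nat by nia.
  rewrite inp_init by lia. simpl. rewrite Nat.sub_0_r.
  rewrite (proj2 (Nat.ltb_lt _ _)) by assumption.
  rewrite Nat.div_add, Nat.div_small, Nat.Div0.mod_add, Nat.mod_small by lia. reflexivity.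
Qed.

Lemma inp_voter v k : (v < m)%nat -> (k < d)%nat -> inp (1 + k + n * d + v * d)%nat = V v k.
Proof.
  intros Hv Hk. assert (k + v * d < m * d)%nat by nia.
  rewrite inp_init by lia. simpl. rewrite Nat.sub_0_r.
  rewrite (proj2 (Nat.ltb_ge _ _)) by lia.
  replace (k + n * d + v * d - n * d)%nat with (k + v * d)%nat by lia.
  rewrite (proj2 (Nat.ltb_lt _ _)) by assumption.
  rewrite Nat.div_add, Nat.div_small, Nat.Div0.mod_add, Nat.mod_small by lia. reflexivity.
Qed.

Lemma inp_rule t : (t < n)%nat -> inp (1 + n * d + m * d + t)%nat = f (S t).
Proof.
  intros Ht. rewrite inp_init by lia. simpl. rewrite Nat.sub_0_r.
  rewrite (proj2 (Nat.ltb_ge _ _)) by lia.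
  rewrite (proj2 (Nat.ltb_ge _ _)) by lia.
  replace (n * d + m * d + t - n * d - m * d)%nat with t by lia.
  rewrite (proj2 (Nat.ltb_lt _ _)) by assumption. reflexivity.
Qed.

Lemma means_eps l env : means inp l env epsE eps.
Proof. apply means_get; [intros a []|apply inp_eps]. Qed.

Lemma means_target l env k : (k < d)%nat -> means inp l env (targetE k) (C 0%nat k).
Proof.
  intros Hk. apply means_get; [intros a []|].
  rewrite <- inp_cand by assumption. unfold addr; simpl. f_equal. lia.
Qed.

Lemma means_cand l env a i k :
  var l env a i -> (i < n)%nat -> (k < d)%nat -> means inp l env (candE d a k) (C i k).
Proof.
  intros [Ha E] Hi Hk. apply means_get.
  - intros b Hb. apply repeat_spec in Hb. lia.
  - rewrite addr_repeat, E. now apply inp_cand.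
Qed.

Lemma means_voter l env a v k :
  in_context l env -> var l env a v -> (v < m)%nat -> (k < d)%nat ->
  means inp l env (voterE d a k) (V v k).
Proof.
  intros [[L0 E0] _] [Ha E] Hv Hk. apply means_get.
  - intros b Hb. apply in_app_iff in Hb as [Hb|Hb]; apply repeat_spec in Hb; lia.
  - rewrite addr_app, !addr_repeat, E, E0. now apply inp_voter.
Qed.

Lemma means_rule l env a t :
  in_context l env -> var l env a t -> (t < n)%nat -> means inp l env (ruleE d a) (f (S t)).
Proof.
  intros [[L0 E0] [L1 E1]] [Ha E] Ht. apply means_get.
  - intros b Hb. rewrite !in_app_iff in Hb.
    destruct Hb as [Hb|[Hb|[<-|[]]]]; [apply repeat_spec in Hb..|]; lia.
  - rewrite !addr_app, !addr_repeat, E0, E1. unfold addr; simpl. rewrite E. now apply inp_rule.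
Qed.

Definition represents l env (X : nat -> lexp) (x : nat -> R) : Prop :=
  forall k, (k < d)%nat -> means inp l env (X k) (x k).

Lemma represents_extends l env l' env' X x :
  extends l env l' env' -> represents l env X x -> represents l' env' X x.
Proof. intros E H k Hk. eapply sat_extends; [exact E|]. now apply H. Qed.

Lemma represents_cand l env a i :
  var l env a i -> (i < n)%nat -> represents l env (candE d a) (C i).
Proof. intros Ha Hi k Hk. now apply means_cand. Qed.

Lemma means_dist l env X x a v :
  in_context l env -> represents l env X x -> var l env a v -> (v < m)%nat ->
  means inp l env (distE d X a) (dinf d x (V v)).
Proof.
  intros G HX Ha Hv. unfold distE, dinf.
  assert (H : forall k, In k (seq 0 d) -> (k < d)%nat) by (intros k Hk; apply in_seq in Hk; lia).
  induction (seq 0 d) as [|k ks IH]; cbn [map fold_right].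
  - apply means_zero.
  - apply means_max; [|apply IH; intros; apply H; now right].
    apply means_abs. apply (means_op inp l env Sub); [apply HX|apply means_voter]; auto;
      apply H; now left.
Qed.

Lemma means_rank_target l env X x a v :
  in_context l env -> represents l env X x -> var l env a v -> (v < m)%nat ->
  means inp l env (rank_targetE d X a) (INR (rank_target d n C x (V v))).
Proof.
  intros G HX Ha Hv. unfold rank_target.
  eapply means_eq.
  - apply means_op; [apply means_one|].
    (* The rank is counted by a sum of indicators; the factor [Nat.ltb 0 i] mirrors the guard
       [if_pos]. *)
    apply (means_sum inp l env false _ n (fun i => if Nat.ltb 0 i
      && Rleb (dinf d (C i) (V v)) (dinf d x (V v)) then 1 else 0)); [apply G|].
    intros i b l' env' Hi E Hb. apply (sat_if_pos inp l' env' b i); [exact Hb| |now intros ->].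
    intros Hpos. rewrite (proj2 (Nat.ltb_lt _ _) Hpos). unfold Rleb; simpl.
    pose proof (in_context_extends _ _ _ _ E G) as G'.
    pose proof (var_extends _ _ _ _ _ _ E Ha) as Ha'.
    eapply sat_cond.
    + apply means_dist; [exact G'|eapply represents_extends; eauto|exact Ha'|exact Hv].
    + apply means_dist; [exact G'|apply represents_cand; eauto|exact Ha'|exact Hv].
    + intros Hlt. destruct (Rle_dec _ _); [lra|apply means_zero].
    + intros Hlt. destruct (Rle_dec _ _); [apply means_one|lra].
  - rewrite rsum_indicator_pos by assumption. simpl arith_fun. rewrite S_INR. lra.
Qed.

Lemma means_rank_other l env X x a v b j :
  in_context l env -> represents l env X x -> var l env a v -> (v < m)%nat ->
  var l env b j -> (j < n)%nat ->
  means inp l env (rank_otherE d X a b) (INR (rank_other d n C x (V v) j)).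
Proof.
  intros G HX Ha Hv Hb Hj. unfold rank_other.
  (* No candidate is strictly closer than itself, so the case [i = j] fails the distance test
     anyway. *)
  rewrite (filter_ext _ (fun i => Rltb (dinf d (C i) (V v)) (dinf d (C j) (V v)))).
  2:{ intros i. destruct (Nat.eqb_spec i j) as [->|]; [|reflexivity].
      unfold Rltb. destruct (Rlt_dec _ _); [lra|reflexivity]. }
  eapply means_eq.
  - apply means_op; [apply means_op; [apply means_one|]|].
    + apply (means_sum inp l env false _ n (fun i => if Nat.ltb 0 i
        && Rltb (dinf d (C i) (V v)) (dinf d (C j) (V v)) then 1 else 0)); [apply G|].
      intros i c l' env' Hi E Hc.
      apply (sat_if_pos inp l' env' c i); [exact Hc| |now intros ->].
      intros Hpos. rewrite (proj2 (Nat.ltb_lt _ _) Hpos). unfold Rltb; simpl.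
      pose proof (in_context_extends _ _ _ _ E G) as G'.
      pose proof (var_extends _ _ _ _ _ _ E Ha) as Ha'.
      pose proof (var_extends _ _ _ _ _ _ E Hb) as Hb'.
      eapply sat_cond.
      * apply means_dist; [exact G'|apply represents_cand; eauto|exact Ha'|exact Hv].
      * apply means_dist; [exact G'|apply represents_cand; eauto|exact Ha'|exact Hv].
      * intros Hlt. destruct (Rlt_dec _ _); [apply means_one|lra].
      * intros Hlt. destruct (Rlt_dec _ _); [lra|apply means_zero].
    + instantiate (1 := INR (if Rltb (dinf d x (V v)) (dinf d (C j) (V v)) then 1 else 0)%nat).
      unfold Rltb. eapply sat_cond.
      * apply means_dist; eassumption.
      * apply means_dist; [exact G|apply represents_cand; eauto|exact Ha|exact Hv].
      * intros Hlt. destruct (Rlt_dec _ _); [apply means_one|lra].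
      * intros Hlt. destruct (Rlt_dec _ _); [lra|apply means_zero].
  - rewrite rsum_indicator_pos by assumption. simpl arith_fun.
    rewrite S_INR, plus_INR. lra.
Qed.

Lemma means_award l env E rk :
  in_context l env -> means inp l env E (INR rk) -> (1 <= rk <= n)%nat ->
  means inp l env (awardE d E) (f rk).
Proof.
  intros G HE Hrk. destruct rk as [|t0]; [lia|].
  rewrite <- (rsum_single (fun t => f (S t)) t0 0 n) by lia.
  apply means_sum; [apply G|]. intros t a l' env' Ht X Ha.
  pose proof (sat_extends _ _ _ _ _ _ _ X HE) as HE'.
  pose proof (means_index inp l' env' 1 a t Ha) as Hi.
  eapply sat_cond; [exact HE'|exact Hi| |]; intros H1.
  - apply INR_lt in H1. destruct (Nat.eqb_spec t t0); [lia|apply means_zero].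
  - eapply sat_cond; [exact Hi|exact HE'| |]; intros H2.
    + apply INR_lt in H2. destruct (Nat.eqb_spec t t0); [lia|apply means_zero].
    + assert (t = t0).
      { apply Nat.le_antisymm; apply Nat.nlt_ge; intros H;
          [apply H1|apply H2]; apply lt_INR; lia. }
      rewrite (proj2 (Nat.eqb_eq _ _)) by assumption.
      apply means_rule; [eapply in_context_extends; eauto|exact Ha|exact Ht].
Qed.

Lemma rank_target_bounds x v : (1 <= rank_target d n C x v <= n)%nat.
Proof.
  unfold rank_target. split; [lia|].
  eapply Nat.le_trans; [apply le_n_S, filter_length_le|]. rewrite length_seq. lia.
Qed.

(** Candidate [j] is not counted against itself, which leaves at most [n - 2] other rivals; the
    target may add one more. The bound keeps the lookup in [awardE] inside the table of [f]. *)
Lemma rank_other_bounds x v j :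
  (1 <= j < n)%nat -> (1 <= rank_other d n C x v j <= n)%nat.
Proof.
  intros Hj. unfold rank_other. split; [lia|].
  match goal with |- context [filter ?p ?xs] =>
    pose proof (filter_length_lt p j xs) as H end.
  rewrite length_seq, Nat.eqb_refl in H. simpl in H.
  specialize (H ltac:(apply in_seq; lia) eq_refl).
  destruct (Rltb _ _); lia.
Qed.

Lemma means_score_target l env X x :
  in_context l env -> represents l env X x ->
  means inp l env (score_targetE d X) (score_target d n m C V f x).
Proof.
  intros G HX. apply means_sum; [apply G|]. intros v a l' env' Hv E Ha.
  pose proof (in_context_extends _ _ _ _ E G) as G'.
  apply means_award; [exact G'| |apply rank_target_bounds].
  apply means_rank_target; auto. eapply represents_extends; eauto.
Qed.

Lemma means_score_other l env X x b j :
  in_context l env -> represents l env X x -> var l env b j -> (1 <= j < n)%nat ->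
  means inp l env (score_otherE d X b) (score_other d n m C V f x j).
Proof.
  intros G HX Hb Hj. apply means_sum; [apply G|]. intros v a l' env' Hv E Ha.
  pose proof (in_context_extends _ _ _ _ E G) as G'.
  apply means_award; [exact G'| |now apply rank_other_bounds].
  apply means_rank_other; auto; [eapply represents_extends; eauto| |lia].
  eapply var_extends; eauto.
Qed.

Lemma indicates_check l env X x :
  in_context l env -> represents l env X x ->
  indicates inp l env (checkE d X) (beats d n m C V f eps x).
Proof.
  intros G HX. unfold checkE, beats.
  assert (H : forall ks, (forall k, In k ks -> (k < d)%nat) ->
    indicates inp l env
      (fold_right (fun k E => cond epsE (absE (op Sub (X k) (targetE k))) zero E)
        (sum false (fun j =>
           if_pos j (cond (score_otherE d X j) (score_targetE d X) zero one))) ks)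
      ((forall k, In k ks -> Rabs (x k - C 0%nat k) <= eps) /\
       exists j, (j < n)%nat /\ ((0 < j)%nat /\
         score_other d n m C V f x j >= score_target d n m C V f x))).
  { induction ks as [|k ks IH]; intros Hks; cbn [fold_right].
    - eapply indicates_iff.
      + apply (indicates_sum inp l env false _ n (fun j => (0 < j)%nat /\
          score_other d n m C V f x j >= score_target d n m C V f x)); [apply G|].
        intros j a l' env' Hj E Ha.
        pose proof (in_context_extends _ _ _ _ E G) as G'.
        pose proof (represents_extends _ _ _ _ _ _ E HX) as HX'.
        apply (sat_if_pos inp l' env' a j); [exact Ha| |].
        * intros Hpos. eapply sat_cond.
          -- apply means_score_other; [exact G'|exact HX'|exact Ha|lia].
          -- apply means_score_target; [exact G'|exact HX'].
          -- intros Hlt. eapply indicates_of_means; [apply means_zero|lra|].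
             split; [lra|intros [_ ?]; lra].
          -- intros Hge. eapply indicates_of_means; [apply means_one|lra|].
             split; [intros _; split; [exact Hpos|lra]|lra].
        * intros ->. split; [lra|]. split; [lra|intros [? _]; lia].
      + split; [intros H; split; [intros k []|exact H]|now intros [_ H]].
    - eapply sat_cond.
      + apply means_eps.
      + apply means_abs. apply (means_op inp l env Sub);
          [apply HX|apply means_target]; apply Hks; now left.
      + simpl. intros Hlt. eapply indicates_of_means; [apply means_zero|lra|].
        split; [lra|]. intros [H _]. specialize (H k (or_introl eq_refl)). lra.
      + simpl. intros Hge. eapply indicates_iff; [apply IH; intros; apply Hks; now right|].
        split; intros [H1 H2]; (split; [|exact H2]).
        * intros k' [<-|Hk']; [lra|auto].
        * intros k' Hk'. apply H1. now right. }
  eapply indicates_iff; [apply H; intros k Hk; apply in_seq in Hk; lia|].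
  split; intros [H1 [j [H2 H3]]]; (split; [|exists j]).
  - intros k Hk. apply H1, in_seq. lia.
  - destruct H3. split; [lia|assumption].
  - intros k Hk. apply in_seq in Hk. apply H1. lia.
  - split; [lia|]. split; [lia|assumption].
Qed.

Lemma indicates_sum_breaks l env k F (Q : R -> Prop) :
  in_context l env -> (k < d)%nat ->
  (forall l' env' E b, extends l env l' env' -> means inp l' env' E b ->
     indicates inp l' env' (F E) (Q b)) ->
  indicates inp l env (sum_breaks d k F)
    (exists b, In b (breaks d n m C V eps k) /\ Q b).
Proof.
  intros G Hk HF. unfold sum_breaks. eapply indicates_iff.
  - apply indicates_add; [apply indicates_add|].
    + apply HF; [apply extends_refl|].
      apply means_op; [now apply means_target|apply means_eps].
    + apply HF; [apply extends_refl|].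
      apply means_op; [now apply means_target|apply means_eps].
    + apply indicates_sum; [apply G|]. intros v a l' env' Hv X Ha.
      instantiate (1 := fun v => exists i, (i < n)%nat /\
        (Q (V v k - dinf d (C i) (V v)) \/ Q (V v k + dinf d (C i) (V v)))).
      pose proof (in_context_extends _ _ _ _ X G) as G'.
      apply indicates_sum; [apply G'|]. intros i b l2 env2 Hi X2 Hb.
      pose proof (in_context_extends _ _ _ _ X2 G') as G2.
      pose proof (var_extends _ _ _ _ _ _ X2 Ha) as Ha2.
      pose proof (extends_trans _ _ _ _ _ _ X X2) as X02.
      pose proof (means_voter l2 env2 a v k G2 Ha2 Hv Hk) as HV.
      pose proof (means_dist l2 env2 _ _ a v G2 (represents_cand _ _ _ _ Hb Hi) Ha2 Hv) as HD.
      apply indicates_add; apply HF; try exact X02.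
      * exact (means_op _ _ _ Sub _ _ _ _ HV HD).
      * exact (means_op _ _ _ Add _ _ _ _ HV HD).
  - simpl arith_fun. split.
    + intros [[H|H]|[v [Hv [i [Hi [H|H]]]]]]; eexists; (split; [apply in_breaks|exact H]);
        auto; right; exists v; split; auto; exists i; auto.
    + intros [b [Hb H]]. apply in_breaks in Hb.
      destruct Hb as [[->| ->]|[v [Hv [i [Hi [->| ->]]]]]]; auto;
        right; exists v; split; auto; exists i; auto.
Qed.

Lemma indicates_search rem : forall l env X x,
  in_context l env -> represents l env X x -> (rem <= d)%nat ->
  indicates inp l env (searchE d rem X) (search d n m C V f eps rem x).
Proof.
  induction rem as [|k IH]; intros l env X x G HX Hk.
  - now apply indicates_check.
  - apply (indicates_sum_breaks l env k _ (fun b => exists b', In b' _ /\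
      search d n m C V f eps k (updR x k ((b + b') / 2)))); [exact G|lia|].
    intros l1 env1 E b X1 HE.
    pose proof (in_context_extends _ _ _ _ X1 G) as G1.
    apply (indicates_sum_breaks l1 env1 k _ (fun b' =>
      search d n m C V f eps k (updR x k ((b + b') / 2)))); [exact G1|lia|].
    intros l2 env2 E' b' X2 HE'.
    pose proof (in_context_extends _ _ _ _ X2 G1) as G2.
    apply IH; [exact G2| |lia]. intros a Ha. unfold updR.
    destruct (Nat.eqb a k).
    + apply (means_op inp l2 env2 Div); [|exact (means_const inp l2 env2 2)].
      apply (means_op inp l2 env2 Add); [|exact HE'].
      eapply sat_extends; [exact X2|exact HE].
    + eapply sat_extends; [exact X2|]. eapply sat_extends; [exact X1|]. now apply HX.
Qed.

End Instance.

(** * Reduction to midpoints of break points *)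

Lemma Rabs_le_bounds a e : Rabs a <= e -> - e <= a <= e.
Proof.
  intros H. pose proof (Rle_abs a). pose proof (Rle_abs (- a)) as H'.
  rewrite Rabs_Ropp in H'. lra.
Qed.

(** A maximum is below [r] iff all its arguments are. The conjunct [0 < r] comes from the base value
    0 of the fold, the only argument when [d = 0]. *)
Lemma dinf_lt d x v r :
  dinf d x v < r <-> 0 < r /\ forall k, (k < d)%nat -> v k - r < x k < v k + r.
Proof.
  assert (H : dinf d x v < r <-> 0 < r /\ forall k, In k (seq 0 d) -> v k - r < x k < v k + r).
  { unfold dinf. induction (seq 0 d) as [|k ks IH]; cbn [map fold_right].
    - split; [intros H; split; [exact H|intros k []]|tauto].
    - rewrite Rmax_Rlt, IH. split.
      + intros [H1 [H2 H3]]. split; [exact H2|]. intros a [<-|Ha]; [|auto].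
        apply Rabs_def2 in H1. lra.
      + intros [H1 H2]. split; [|split; [exact H1|intros; apply H2; now right]].
        specialize (H2 k (or_introl eq_refl)). apply Rabs_def1; lra. }
  rewrite H. split; intros [H1 H2]; (split; [exact H1|]).
  - intros k Hk. apply H2, in_seq. lia.
  - intros k Hk. apply in_seq in Hk. apply H2. lia.
Qed.

(** Preserving both strict comparisons also preserves equality with members of [L]. *)
Definition same_order (L : list R) (a b : R) : Prop :=
  forall c, In c L -> (a < c <-> b < c) /\ (c < a <-> c < b).

Lemma greatest_below (x b : R) L :
  b <= x -> exists lo, In lo (b :: L) /\ lo <= x /\ forall c, In c (b :: L) -> c <= x -> c <= lo.
Proof.
  intros Hb. induction L as [|c L [lo [H1 [H2 H3]]]].
  - exists b. split; [now left|split; [exact Hb|]]. intros c [<-|[]] _; lra.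
  - destruct (Rle_dec c x) as [Hc|Hc], (Rle_dec lo c) as [Hlc|Hlc].
    + exists c. split; [simpl; auto|split; [exact Hc|]].
      intros a [<-|[<-|Ha]] Hax; [|lra|].
      * specialize (H3 b (or_introl eq_refl) Hax). lra.
      * specialize (H3 a (or_intror Ha) Hax). lra.
    + exists lo. split; [simpl in *; tauto|split; [exact H2|]].
      intros a [<-|[<-|Ha]] Hax; [|lra|]; apply H3; simpl; auto.
    + exists lo. split; [simpl in *; tauto|split; [exact H2|]].
      intros a [<-|[<-|Ha]] Hax; [|lra|]; apply H3; simpl; auto.
    + exists lo. split; [simpl in *; tauto|split; [exact H2|]].
      intros a [<-|[<-|Ha]] Hax; [|lra|]; apply H3; simpl; auto.
Qed.

(* A point of [L] is the midpoint of itself and itself; any other point between the extreme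
   members of [L] can slide to the midpoint of its two neighbours in [L]. *)
Lemma midpoint_same_order L x b1 b2 :
  In b1 L -> b1 <= x -> In b2 L -> x <= b2 ->
  exists lo hi, In lo L /\ In hi L /\ same_order L ((lo + hi) / 2) x.
Proof.
  intros I1 H1 I2 H2.
  destruct (greatest_below x b1 L H1) as [lo [Il [Hl Ml]]].
  (* The least member at or above [x] is obtained by negating the list and taking the greatest
     member at or below [- x]. *)
  destruct (greatest_below (- x) (- b2) (map Ropp L) ltac:(lra)) as [h [Ih [Hh Mh]]].
  change (- b2 :: map Ropp L) with (map Ropp (b2 :: L)) in Ih, Mh.
  apply in_map_iff in Ih as [hi [<- Ih]].
  exists lo, hi. split; [destruct Il as [<-|]; assumption|].
  split; [destruct Ih as [<-|]; assumption|].
  intros c Hc.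
  assert (A : c <= x -> c <= lo) by (intros; apply Ml; [now right|assumption]).
  assert (B : x <= c -> hi <= c).
  { intros. assert (- c <= - hi); [|lra]. apply Mh; [apply in_map; now right|lra]. }
  destruct (Rtotal_order c x) as [Hlt|[->|Hgt]].
  - specialize (A ltac:(lra)). split; split; lra.
  (* Here [x] itself belongs to [L], which forces [lo = hi = x]. *)
  - specialize (A ltac:(lra)). specialize (B ltac:(lra)). split; split; lra.
  - specialize (B ltac:(lra)). split; split; lra.
Qed.

(** The position of the target enters the ranks only through comparisons of its distance to a voter
    with the distance of another candidate, and [dinf_lt] turns these into comparisons with break
    points. *)
Lemma beats_same_order d n m C V f eps x z :
  (forall k, (k < d)%nat -> same_order (breaks d n m C V eps k) (z k) (x k)) ->
  beats d n m C V f eps x -> beats d n m C V f eps z.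
Proof.
  intros Hz [Hr [j [Hj Hs]]].
  assert (D : forall v i, (v < m)%nat -> (i < n)%nat ->
    (dinf d z (V v) < dinf d (C i) (V v) <-> dinf d x (V v) < dinf d (C i) (V v))).
  { intros v i Hv Hi. rewrite !dinf_lt.
    assert (K : forall k, (k < d)%nat ->
      (V v k - dinf d (C i) (V v) < z k < V v k + dinf d (C i) (V v)
       <-> V v k - dinf d (C i) (V v) < x k < V v k + dinf d (C i) (V v))).
    { intros k Hk.
      destruct (Hz k Hk (V v k - dinf d (C i) (V v))) as [_ A].
      { apply in_breaks. right. exists v; split; auto; exists i; auto. }
      destruct (Hz k Hk (V v k + dinf d (C i) (V v))) as [B _].
      { apply in_breaks. right. exists v; split; auto; exists i; auto. }
      rewrite A, B. reflexivity. }
    split; intros [H0 H]; (split; [exact H0|]); intros k Hk; apply K; auto. }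
  split.
  - intros k Hk. specialize (Hr k Hk).
    destruct (Hz k Hk (C 0%nat k - eps)) as [A _]; [apply in_breaks; auto|].
    destruct (Hz k Hk (C 0%nat k + eps)) as [_ B]; [apply in_breaks; auto|].
    apply Rabs_le. apply Rabs_le_bounds in Hr.
    (* The closed bounds are negations of strict comparisons with the two break points given by
       [eps]. *)
    assert (~ z k < C 0%nat k - eps) by (rewrite A; lra).
    assert (~ C 0%nat k + eps < z k) by (rewrite B; lra). lra.
  - exists j. split; [exact Hj|].
    replace (score_other d n m C V f z j) with (score_other d n m C V f x j).
    + replace (score_target d n m C V f z) with (score_target d n m C V f x); [exact Hs|].
      unfold score_target. f_equal. apply map_ext_in. intros v Hv. apply in_seq in Hv.
      f_equal. unfold rank_target. do 2 f_equal. apply filter_ext_in.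
      intros i Hi. apply in_seq in Hi. specialize (D v i ltac:(lia) ltac:(lia)).
      unfold Rleb. destruct (Rle_dec _ _) as [H1|H1], (Rle_dec _ _) as [H2|H2]; auto; lra.
    + unfold score_other. f_equal. apply map_ext_in. intros v Hv. apply in_seq in Hv.
      f_equal. unfold rank_other. do 2 f_equal.
      specialize (D v j ltac:(lia) ltac:(lia)). unfold Rltb.
      destruct (Rlt_dec _ _) as [H1|H1], (Rlt_dec _ _) as [H2|H2]; auto; tauto.
Qed.

Lemma search_sound d n m C V f eps rem : forall x,
  search d n m C V f eps rem x -> exists z, beats d n m C V f eps z.
Proof.
  induction rem as [|k IH]; intros x H; [now exists x|].
  destruct H as [b [_ [b' [_ H]]]]. eauto.
Qed.

(** Invariant of the descent: the coordinates of [z] from [rem] on are already in the same order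
    position as those of the winning [x], and the lower ones are still to be overwritten. The break
    points do not depend on [x], so each coordinate is treated on its own. *)
Lemma search_complete d n m C V f eps x rem : forall z,
  beats d n m C V f eps x -> (rem <= d)%nat ->
  (forall k, (rem <= k < d)%nat -> same_order (breaks d n m C V eps k) (z k) (x k)) ->
  search d n m C V f eps rem z.
Proof.
  induction rem as [|k IH]; intros z Hx Hrem Hz.
  - apply (beats_same_order d n m C V f eps x); [|exact Hx]. intros k Hk. apply Hz. lia.
  - pose proof (proj1 Hx k ltac:(lia)) as Hr. apply Rabs_le_bounds in Hr.
    (* Feasibility of [x] puts [x k] between the two break points given by [eps], so it has a
       neighbour on each side. *)
    destruct (midpoint_same_order (breaks d n m C V eps k) (x k)
      (C 0%nat k - eps) (C 0%nat k + eps)) as [b [b' [Hb [Hb' Ho]]]];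
      [apply in_breaks; auto|lra|apply in_breaks; auto|lra|].
    exists b. split; [exact Hb|]. exists b'. split; [exact Hb'|].
    apply IH; [exact Hx|lia|]. intros a Ha. unfold updR.
    destruct (Nat.eqb_spec a k) as [->|]; [exact Ho|apply Hz; lia].
Qed.

Theorem theorem9 :
  forall d : nat,
  exists (P : list instr) (c k : nat),
  forall (n m : nat) (C V : nat -> nat -> R) (f : nat -> R) (eps : R),
    (0 < n)%nat ->
    0 < eps ->
    (forall t, (1 <= t)%nat -> (t < n)%nat -> f (S t) <= f t) ->
    (forall v i j, (v < m)%nat -> (i < n)%nat -> (j < n)%nat -> i <> j ->
        dinf d (C i) (V v) <> dinf d (C j) (V v)) ->
    exists (t : nat) (s : state),
      (t <= c * (n + m + 1) ^ k)%nat /\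
      steps P (init_state d n m C V f eps) t = Some s /\
      halted P s /\
      (Nreg s 0 <> 0%nat <-> destructive_control d n m C V f eps).
Proof.
  (* The level starts at 3 because nat registers 0, 1 and 2 hold [n], [m] and the address of the
     copy. The zero point is a placeholder: the search overwrites all [d] coordinates. *)
  intros d. set (e := searchE d d (fun _ => zero) 3%nat).
  destruct (program_correct d e) as [c [k H]].
  exists (program d e), c, k. intros n m C V f eps Hn _ _ _.
  destruct (H n m (Nreg (init_state d n m C V f eps)) (Rreg (init_state d n m C V f eps))
              eq_refl eq_refl) as [t [s [inp [env [Ht [Es [Hh [Hi [E0 [E1 Ho]]]]]]]]]].
  exists t, s. split; [exact Ht|split; [exact Es|split; [exact Hh|]]]. rewrite Ho.
  destruct (indicates_search d n m C V f eps inp Hn Hi d 3 env (fun _ => zero) (fun _ => 0)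
              ltac:(split; split; auto) (fun k _ => means_zero inp 3 env) (Nat.le_refl d)
              3%nat env (extends_refl 3 env)) as [_ Hs].
  unfold e. rewrite Hs. split.
  - intros Hx. apply search_sound in Hx as [x Hx]. now exists x.
  - intros [x Hx]. apply (search_complete d n m C V f eps x); [exact Hx|lia|].
    intros a Ha. lia.
Qed.
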